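(* Let $\mathbf H=(\underline H,\overline H,\omega)$ be a compatible weak (monad-comonad) entwining on a category $\mathbb A$, for which the idempotent $\Gamma'$ splits, so that the induced monad $\mathbf T$ on $\mathbb A^{\overline H}$ is defined. Then the functor $K':\mathbb A\to(\mathbb A^{\overline H})_{\mathbf T}$ (and hence also $K_\omega:\mathbb A\to\mathbb A^{\overline H}_{\underline H}(\omega)$) has a left adjoint if and only if, for any $(a,h,\theta)\in\mathbb A^{\overline H}_{\underline H}(\omega)$, the pair of morphisms $$h,\quad \varepsilon_a\cdot m_a\cdot H(\theta)\;:\;H(a)\rightrightarrows a$$ has a coequaliser in $\mathbb A$.
   Context: $\cdot$ is vertical composition of natural transformations and juxtaposition is composition of functors and whiskering. $\mathbb A_{\underline H}$, $\mathbb A^{\overline H}$ are the Eilenberg–Moore categories of modules of the monad $\underline H$ and comodules of the comonad $\overline H$; $(\mathbb A^{\overline H})_{\mathbf T}$ is the category of $\mathbf T$-modules in $\mathbb A^{\overline H}$. Weak entwining. Let $\underline H=(H,m,e)$ be a monad and $\overline H=(H,\delta,\varepsilon)$ a comonad on $\mathbb A$ with the same endofunctor $H$. For $\omega:HH\to HH$ put $\xi:=\varepsilon H\cdot\omega\cdot eH:H\to H$. $(\underline H,\overline H,\omega)$ is a weak entwining if (i) $\omega\cdot mH=Hm\cdot\omega H\cdot H\omega$ and $\delta H\cdot\omega=H\omega\cdot\omega H\cdot H\delta$; (ii) $\omega\cdot eH=H\xi\cdot\delta$ and $\varepsilon H\cdot\omega=m\cdot H\xi$. It is compatible if $\delta\cdot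 m=Hm\cdot\omega H\cdot H\delta$. Mixed bimodules. $\mathbb A^{\overline H}_{\underline H}(\omega)$ has as objects triples $(a,h,\theta)$ with $(a,h)\in\mathbb A_{\underline H}$, $(a,\theta)\in\mathbb A^{\overline H}$ and $\theta\cdot h=H(h)\cdot\omega_a\cdot H(\theta)$; morphisms are morphisms of $\mathbb A$ that are both $\underline H$-module and $\overline H$-comodule morphisms. By compatibility there is a functor $K_\omega:\mathbb A\to\mathbb A^{\overline H}_{\underline H}(\omega)$, $a\mapsto(H(a),m_a,\delta_a)$. Induced monad $\mathbf T$. For $(a,\theta)\in\mathbb A^{\overline H}$ the morphism $\Gamma'_{(a,\theta)}:=\varepsilon_{H(a)}\cdot\omega_a\cdot H(\theta):H(a)\to H(a)$ is a natural idempotent; let $\Gamma'=i'\cdot p'$, $p'\cdot i'=1$, with $p'_{(a,\theta)}:H(a)\to T(a,\theta)$, $i'_{(a,\theta)}:T(a,\theta)\to H(a)$, be its splitting. The functor part of $\mathbf T$ sends $(a,\theta)$ to $T(a,\theta)$ with comodule structure $H(p'_{(a,\theta)})\cdot\omega_a\cdot H(\theta)\cdot i'_{(a,\theta)}$; its multiplication is $p'_{(a,\theta)}\cdot m_a\cdot H(i'_{(a,\theta)})\cdot i'_{T(a,\theta)}:TT(a,\theta)\to T(a,\theta)$ and its unit is $p'_{(a,\theta)}\cdot\theta$. There is an isomorphism of categories $\Phi':\mathbb A^{\overline H}_{\underline H}(\omega)\to(\mathbb A^{\overline H})_{\mathbf T}$, $(a,h,\theta)\mapsto((a,\theta),h\cdot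 i'_{(a,\theta)})$, and $K':=\Phi'K_\omega$, i.e. $K'(a)=((H(a),\delta_a),\,m_a\cdot i'_{(H(a),\delta_a)})$.
   Formalization: The unit of the induced monad T is taken to be p'·e_a (e the unit of the monad H) instead of the printed p'·θ, which fails the unit laws already for an ordinary bialgebra, so that T would not be a monad. *)

(* Defs.v *)
(* The only axiom used is proof irrelevance, so that two morphisms
   of (co)modules are equal as soon as the underlying morphisms are. *)
From Stdlib Require Import ProofIrrelevance.

Set Implicit Arguments.
Unset Strict Implicit.
Unset Printing Implicit Defensive.

Declare Scope cat_scope.
Open Scope cat_scope.

Record category := Category {
  obj :> Type;
  hom : obj -> obj -> Type;
  idm : forall a, hom a a;
  comp : forall a b c, hom b c -> hom a b -> hom a c;
  comp_idl : forall a b (f : hom a b), comp (idm b) f = f;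
  comp_idr : forall a b (f : hom a b), comp f (idm a) = f;
  comp_assoc : forall a b c d (h : hom c d) (g : hom b c) (f : hom a b),
    comp (comp h g) f = comp h (comp g f) }.

Arguments hom {c} _ _ : rename.
Arguments idm {c} _ : rename.
Arguments comp {c a b c0} _ _ : rename.
Notation "g ∘ f" := (comp g f) (at level 40, f at level 40, right associativity)
  : cat_scope.

Record functor (A B : category) := Functor {
  fobj :> A -> B;
  fmap : forall a b, hom a b -> hom (fobj a) (fobj b);
  fmap_id : forall a, fmap (idm a) = idm (fobj a);
  fmap_comp : forall a b c (g : hom b c) (f : hom a b),
    fmap (g ∘ f) = fmap g ∘ fmap f }.

Arguments fmap {A B} _ {a b} _.

Lemma comp_functor_id (A B C : category) (G : functor B C) (F : functor A B) a :
  fmap G (fmap F (idm a)) = idm (G (F a)).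
Proof. now rewrite !fmap_id. Qed.

Lemma comp_functor_comp (A B C : category) (G : functor B C) (F : functor A B)
    a b c (g : hom b c) (f : hom a b) :
  fmap G (fmap F (g ∘ f)) = fmap G (fmap F g) ∘ fmap G (fmap F f).
Proof. now rewrite !fmap_comp. Qed.

Definition comp_functor (A B C : category) (G : functor B C) (F : functor A B) :
    functor A C :=
  Functor (fobj := fun a => G (F a)) (fmap := fun a b f => fmap G (fmap F f))
    (comp_functor_id G F) (@comp_functor_comp A B C G F).

Record adjunction (A B : category) (F : functor B A) (G : functor A B) := {
  adj_unit : forall b : B, hom b (G (F b));
  adj_counit : forall a : A, hom (F (G a)) a;
  adj_unit_nat : forall b b' (f : hom b b'),
    adj_unit b' ∘ f = fmap G (fmap F f) ∘ adj_unit b;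
  adj_counit_nat : forall a a' (f : hom a a'),
    adj_counit a' ∘ fmap F (fmap G f) = f ∘ adj_counit a;
  adj_triangle_left : forall b,
    adj_counit (F b) ∘ fmap F (adj_unit b) = idm (F b);
  adj_triangle_right : forall a,
    fmap G (adj_counit a) ∘ adj_unit (G a) = idm (G a) }.

Definition has_left_adjoint (A B : category) (G : functor A B) : Prop :=
  exists F : functor B A, inhabited (adjunction F G).

Definition is_coequaliser (A : category) (a b c : A) (f g : hom a b) (q : hom b c) :
    Prop :=
  q ∘ f = q ∘ g /\
  forall (z : A) (k : hom b z), k ∘ f = k ∘ g -> exists! u : hom c z, u ∘ q = k.

Definition has_coequaliser (A : category) (a b : A) (f g : hom a b) : Prop :=
  exists (c : A) (q : hom b c), is_coequaliser f g q.

Record monad (A : category) (H : functor A A) := Monad {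
  mu : forall a, hom (H (H a)) (H a);
  eta : forall a, hom a (H a);
  mu_nat : forall a b (f : hom a b), mu b ∘ fmap H (fmap H f) = fmap H f ∘ mu a;
  eta_nat : forall a b (f : hom a b), eta b ∘ f = fmap H f ∘ eta a;
  mu_assoc : forall a, mu a ∘ fmap H (mu a) = mu a ∘ mu (H a);
  mu_etal : forall a, mu a ∘ eta (H a) = idm (H a);
  mu_etar : forall a, mu a ∘ fmap H (eta a) = idm (H a) }.

Record comonad (A : category) (H : functor A A) := Comonad {
  delta : forall a, hom (H a) (H (H a));
  eps : forall a, hom (H a) a;
  delta_nat : forall a b (f : hom a b),
    delta b ∘ fmap H f = fmap H (fmap H f) ∘ delta a;
  eps_nat : forall a b (f : hom a b), eps b ∘ fmap H f = f ∘ eps a;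
  delta_coassoc : forall a, fmap H (delta a) ∘ delta a = delta (H a) ∘ delta a;
  eps_deltal : forall a, eps (H a) ∘ delta a = idm (H a);
  eps_deltar : forall a, fmap H (eps a) ∘ delta a = idm (H a) }.

Lemma sig_inj (X : Type) (P : X -> Prop) (x y : sig P) :
  proj1_sig x = proj1_sig y -> x = y.
Proof.
destruct x as [x px], y as [y py]; simpl; intros e; now apply subset_eq_compat.
Qed.

Lemma reassoc (A : category) (a b c : A) (g : hom b c) (f : hom a b) (k : hom a c)
    (e : g ∘ f = k) z (x : hom z a) : g ∘ f ∘ x = k ∘ x.
Proof. now rewrite <- e, comp_assoc. Qed.

Lemma reassoc3 (A : category) (a b c d : A) (h : hom c d) (g : hom b c) (f : hom a b)
    (k : hom a d) (e : h ∘ g ∘ f = k) z (x : hom z a) : h ∘ g ∘ f ∘ x = k ∘ x.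
Proof. now rewrite <- e, !comp_assoc. Qed.

Lemma fmap_eq (A B : category) (F : functor A B) (a b c : A) (g : hom b c)
    (f : hom a b) (k : hom a c) (e : g ∘ f = k) : fmap F g ∘ fmap F f = fmap F k.
Proof. now rewrite <- e, fmap_comp. Qed.

Ltac flat := repeat progress (rewrite ?fmap_comp, ?fmap_id, ?comp_idl, ?comp_idr,
  ?comp_assoc).
Tactic Notation "rw" uconstr(E) :=
  flat; first [rewrite E | rewrite (reassoc E) | rewrite (reassoc3 E)]; flat.
Tactic Notation "rwl" uconstr(E) :=
  flat; first [rewrite (eq_sym E) | rewrite (reassoc (eq_sym E))
    | rewrite (reassoc3 (eq_sym E))]; flat.

Section EilenbergMoore.
Context (A : category) (H : functor A A).

Section Modules.
Context (M : monad H).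

Definition is_module (a : A) (h : hom (H a) a) : Prop :=
  h ∘ fmap H h = h ∘ mu M a /\ h ∘ eta M a = idm a.

Record module := Module {
  mod_obj : A;
  act : hom (H mod_obj) mod_obj;
  moduleP : is_module act }.

Definition is_module_mor (X Y : module) (f : hom (mod_obj X) (mod_obj Y)) : Prop :=
  f ∘ act X = act Y ∘ fmap H f.

Definition module_hom (X Y : module) := {f | @is_module_mor X Y f}.

Lemma module_id_mor X : @is_module_mor X X (idm _).
Proof. unfold is_module_mor; now flat. Qed.

Lemma module_comp_mor X Y Z (g : module_hom Y Z) (f : module_hom X Y) :
  @is_module_mor X Z (proj1_sig g ∘ proj1_sig f).
Proof.
destruct g as [g pg], f as [f pf]; unfold is_module_mor in *; simpl; flat.
now rewrite pf, <- comp_assoc, pg, comp_assoc.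
Qed.

Definition module_id X : module_hom X X := exist _ _ (module_id_mor X).
Definition module_comp X Y Z (g : module_hom Y Z) (f : module_hom X Y) :
  module_hom X Z := exist _ _ (module_comp_mor g f).

Definition module_cat : category.
Proof.
refine (@Category module module_hom module_id module_comp _ _ _);
  intros; apply sig_inj; simpl; now flat.
Defined.

End Modules.

Section Comodules.
Context (C : comonad H).

Definition is_comodule (a : A) (t : hom a (H a)) : Prop :=
  fmap H t ∘ t = delta C a ∘ t /\ eps C a ∘ t = idm a.

Record comodule := Comodule {
  comod_obj : A;
  coact : hom comod_obj (H comod_obj);
  comoduleP : is_comodule coact }.

Definition is_comodule_mor (X Y : comodule) (f : hom (comod_obj X) (comod_obj Y)) :
    Prop :=
  coact Y ∘ f = fmap H f ∘ coact X.

Definition comodule_hom (X Y : comodule) := {f | @is_comodule_mor X Y f}.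

Lemma comodule_id_mor X : @is_comodule_mor X X (idm _).
Proof. unfold is_comodule_mor; now flat. Qed.

Lemma comodule_comp_mor X Y Z (g : comodule_hom Y Z) (f : comodule_hom X Y) :
  @is_comodule_mor X Z (proj1_sig g ∘ proj1_sig f).
Proof.
destruct g as [g pg], f as [f pf]; unfold is_comodule_mor in *; simpl; flat.
now rewrite <- pf, <- !comp_assoc, pg.
Qed.

Definition comodule_id X : comodule_hom X X := exist _ _ (comodule_id_mor X).
Definition comodule_comp X Y Z (g : comodule_hom Y Z) (f : comodule_hom X Y) :
  comodule_hom X Z := exist _ _ (comodule_comp_mor g f).

Definition comodule_cat : category.
Proof.
refine (@Category comodule comodule_hom comodule_id comodule_comp _ _ _);
  intros; apply sig_inj; simpl; now flat.
Defined.

Lemma cofree_comodule a : is_comodule (delta C a).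
Proof. split; [apply delta_coassoc | apply eps_deltal]. Qed.

End Comodules.
End EilenbergMoore.

Lemma free_module (A : category) (H : functor A A) (M : monad H) (a : A) :
  is_module M (mu M a).
Proof. split; [apply mu_assoc | apply mu_etal]. Qed.

Section Entwining.
Context (A : category) (H : functor A A) (M : monad H) (C : comonad H).

Definition xi_of (w : forall a, hom (H (H a)) (H (H a))) (a : A) : hom (H a) (H a) :=
  eps C (H a) ∘ w a ∘ eta M (H a).

Record weak_entwining := WeakEntwining {
  omega : forall a, hom (H (H a)) (H (H a));
  omega_nat : forall a b (f : hom a b),
    omega b ∘ fmap H (fmap H f) = fmap H (fmap H f) ∘ omega a;
  omega_mu : forall a,
    omega a ∘ mu M (H a) = fmap H (mu M a) ∘ omega (H a) ∘ fmap H (omega a);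
  omega_delta : forall a,
    delta C (H a) ∘ omega a = fmap H (omega a) ∘ omega (H a) ∘ fmap H (delta C a);
  omega_eta : forall a,
    omega a ∘ eta M (H a) = fmap H (xi_of omega a) ∘ delta C a;
  omega_eps : forall a,
    eps C (H a) ∘ omega a = mu M a ∘ fmap H (xi_of omega a) }.

Definition compatible (W : weak_entwining) : Prop :=
  forall a, delta C a ∘ mu M a =
            fmap H (mu M a) ∘ omega W (H a) ∘ fmap H (delta C a).

Context (W : weak_entwining).

Definition is_mixed_bimodule (a : A) (h : hom (H a) a) (t : hom a (H a)) : Prop :=
  is_module M h /\ is_comodule C t /\ t ∘ h = fmap H h ∘ omega W a ∘ fmap H t.

Record bimodule := Bimodule {
  bim_obj : A;
  bim_act : hom (H bim_obj) bim_obj;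
  bim_coact : hom bim_obj (H bim_obj);
  bimoduleP : is_mixed_bimodule bim_act bim_coact }.

Definition bim_mod (X : bimodule) : module M := Module (proj1 (bimoduleP X)).
Definition bim_comod (X : bimodule) : comodule C :=
  Comodule (proj1 (proj2 (bimoduleP X))).

Definition is_bimodule_mor (X Y : bimodule) (f : hom (bim_obj X) (bim_obj Y)) : Prop :=
  @is_module_mor _ _ _ (bim_mod X) (bim_mod Y) f /\
  @is_comodule_mor _ _ _ (bim_comod X) (bim_comod Y) f.

Definition bimodule_hom (X Y : bimodule) := {f | @is_bimodule_mor X Y f}.

Definition bimodule_id (X : bimodule) : bimodule_hom X X :=
  exist _ (idm (bim_obj X))
    (conj (module_id_mor (bim_mod X)) (comodule_id_mor (bim_comod X))).

Lemma bimodule_comp_mor X Y Z (g : bimodule_hom Y Z) (f : bimodule_hom X Y) :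
  @is_bimodule_mor X Z (proj1_sig g ∘ proj1_sig f).
Proof.
destruct g as [g [g1 g2]], f as [f [f1 f2]]; split.
- exact (module_comp_mor (exist _ g g1 : module_hom (bim_mod Y) (bim_mod Z))
                         (exist _ f f1 : module_hom (bim_mod X) (bim_mod Y))).
- exact (comodule_comp_mor
           (exist _ g g2 : comodule_hom (bim_comod Y) (bim_comod Z))
           (exist _ f f2 : comodule_hom (bim_comod X) (bim_comod Y))).
Qed.

Definition bimodule_comp X Y Z (g : bimodule_hom Y Z) (f : bimodule_hom X Y) :
  bimodule_hom X Z := exist _ _ (bimodule_comp_mor g f).

Definition bimodule_cat : category.
Proof.
refine (@Category bimodule bimodule_hom bimodule_id bimodule_comp _ _ _);
  intros; apply sig_inj; simpl; now flat.
Defined.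

Section FunctorK.
Context (Wc : compatible W).

Lemma K_obj_proof (a : A) : is_mixed_bimodule (mu M a) (delta C a).
Proof. split; [apply free_module | split; [apply cofree_comodule | apply Wc]]. Qed.

Definition K_obj (a : A) : bimodule := Bimodule (K_obj_proof a).

Lemma K_mor_proof (a b : A) (f : hom a b) : @is_bimodule_mor (K_obj a) (K_obj b) (fmap H f).
Proof. split; [symmetry; apply mu_nat | apply delta_nat]. Qed.

Definition K_omega : functor A bimodule_cat.
Proof.
refine (@Functor A bimodule_cat K_obj (fun a b f => exist _ _ (K_mor_proof f)) _ _);
  intros; apply sig_inj; simpl; [apply fmap_id | apply fmap_comp].
Defined.

End FunctorK.

Definition Gamma' (X : comodule C) : hom (H (comod_obj X)) (H (comod_obj X)) :=
  eps C (H (comod_obj X)) ∘ omega W (comod_obj X) ∘ fmap H (coact X).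

End Entwining.

Record splitting (A : category) (a : A) (g : hom a a) := Splitting {
  spl_obj : A;
  spl_p : hom a spl_obj;
  spl_i : hom spl_obj a;
  spl_ip : spl_i ∘ spl_p = g;
  spl_pi : spl_p ∘ spl_i = idm spl_obj }.

Section InducedMonad.
Context (A : category) (H : functor A A) (M : monad H) (C : comonad H)
  (W : weak_entwining M C) (S : forall X : comodule C, splitting (Gamma' W X)).

Local Notation u := (@comod_obj A H C).
Local Notation m := (mu M).
Local Notation G := (Gamma' W).

(* A coassociative, but in general not counital, coaction on H(a), with
   eps · wcoact = Γ'. *)
Definition wcoact (X : comodule C) : hom (H (u X)) (H (H (u X))) :=
  omega W (u X) ∘ fmap H (coact X).

Lemma eps_wcoact X : eps C _ ∘ wcoact X = G X.
Proof. reflexivity. Qed.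

Lemma delta_wcoact X : delta C _ ∘ wcoact X = fmap H (wcoact X) ∘ wcoact X.
Proof.
unfold wcoact; flat. rw (omega_delta W _). rw (fmap_eq H (eq_sym (proj1 (comoduleP X)))).
now rw (omega_nat W _).
Qed.

Lemma Gamma_wcoact X : fmap H (G X) ∘ wcoact X = wcoact X.
Proof. rewrite <- eps_wcoact; flat. rewrite <- delta_wcoact. now rw (eps_deltar C _). Qed.

Lemma wcoact_Gamma X : wcoact X ∘ G X = wcoact X.
Proof.
rewrite <- eps_wcoact. rwl (eps_nat C (wcoact X)). rewrite <- delta_wcoact.
now rw (eps_deltal C _).
Qed.

Lemma wcoact_nat X Y (f : hom (u X) (u Y)) :
  is_comodule_mor f -> wcoact Y ∘ fmap H f = fmap H (fmap H f) ∘ wcoact X.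
Proof. intros e; unfold wcoact; flat. rw (fmap_eq H e). now rw (omega_nat W _). Qed.

Lemma Gamma_nat X Y (f : hom (u X) (u Y)) :
  is_comodule_mor f -> G Y ∘ fmap H f = fmap H f ∘ G X.
Proof.
intros e; rewrite <- !eps_wcoact; flat. rewrite (wcoact_nat e). now rw (eps_nat C _).
Qed.

Lemma T_obj_proof X :
  is_comodule C
    (fmap H (spl_p (S X)) ∘ omega W (comod_obj X) ∘ fmap H (coact X) ∘ spl_i (S X)).
Proof.
assert (e : fmap H (spl_p (S X)) ∘ omega W (u X) ∘ fmap H (coact X) ∘ spl_i (S X) =
  fmap H (spl_p (S X)) ∘ wcoact X ∘ spl_i (S X)) by (unfold wcoact; now flat).
rewrite e; split; flat.
- rw (fmap_eq H (spl_ip (S X))). rw (Gamma_wcoact X). rwl (delta_wcoact X).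
  now rw (delta_nat C _).
- rw (eps_nat C _). rw (eps_wcoact X). rewrite <- (spl_pi (S X)).
  pose proof (reassoc (spl_ip (S X)) (spl_i (S X))) as r.
  rewrite spl_pi, comp_idr in r; now rewrite <- r.
Qed.

Definition T_obj (X : comodule C) : comodule C := Comodule (T_obj_proof X).

Definition T_p (X : comodule C) : hom (H (comod_obj X)) (comod_obj (T_obj X)) :=
  spl_p (S X).
Definition T_i (X : comodule C) : hom (comod_obj (T_obj X)) (H (comod_obj X)) :=
  spl_i (S X).

Local Notation p X := (T_p X).
Local Notation i X := (T_i X).

Lemma T_coact X : coact (T_obj X) = fmap H (p X) ∘ wcoact X ∘ i X.
Proof. unfold wcoact, T_p, T_i; cbn; now flat. Qed.

Lemma T_ip X : i X ∘ p X = G X.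
Proof. apply spl_ip. Qed.

Lemma T_pi X : p X ∘ i X = idm _.
Proof. apply spl_pi. Qed.

Local Opaque T_obj T_p T_i.

Lemma Gamma_i X : G X ∘ i X = i X.
Proof. rewrite <- (T_ip X). now rw (T_pi X). Qed.

Lemma p_Gamma X : p X ∘ G X = p X.
Proof. rewrite <- (T_ip X). now rw (T_pi X). Qed.

Lemma T_i_inj X a (f g : hom a _) : i X ∘ f = i X ∘ g -> f = g.
Proof.
intros e; rewrite <- (comp_idl f), <- (comp_idl g), <- (T_pi X); flat.
now rewrite e.
Qed.

Lemma T_mor_proof X Y (f : comodule_hom X Y) :
  @is_comodule_mor _ _ _ (T_obj X) (T_obj Y) (T_p Y ∘ fmap H (proj1_sig f) ∘ T_i X).
Proof.
destruct f as [f e]; unfold is_comodule_mor; rewrite !T_coact; cbn; flat.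
rw (T_ip Y). rw (wcoact_Gamma Y). rw (wcoact_nat e). rw (fmap_eq H (T_ip X)). now rw (Gamma_wcoact X).
Qed.

Definition T_mor X Y (f : comodule_hom X Y) : comodule_hom (T_obj X) (T_obj Y) :=
  exist _ _ (T_mor_proof f).

Definition T_functor : functor (comodule_cat C) (comodule_cat C).
Proof.
refine (@Functor (comodule_cat C) (comodule_cat C) T_obj T_mor _ _);
  intros; apply sig_inj; cbn; flat.
- apply T_pi.
- rw (T_ip b). rw (Gamma_nat (proj2_sig f)). now rw (Gamma_i a).
Defined.

Lemma wcoact_mu X :
  wcoact X ∘ m (u X) ∘ fmap H (i X) =
  fmap H (m (u X)) ∘ fmap H (fmap H (i X)) ∘ wcoact (T_obj X).
Proof.
unfold wcoact at 2; rewrite T_coact; flat.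
rwl (omega_nat W _). rw (fmap_eq H (fmap_eq H (T_ip X))). rw (fmap_eq H (Gamma_wcoact X)).
unfold wcoact; flat. rwl (mu_nat M _). now rw (omega_mu W _).
Qed.

Lemma Gamma_mu X :
  G X ∘ m (u X) ∘ fmap H (i X) = m (u X) ∘ fmap H (i X) ∘ G (T_obj X).
Proof.
rewrite <- !eps_wcoact; flat. rewrite wcoact_mu. rw (eps_nat C (m (u X))).
now rw (eps_nat C (fmap H (i X))).
Qed.

Lemma Gamma_mu_i X :
  G X ∘ m (u X) ∘ fmap H (i X) ∘ i (T_obj X) = m (u X) ∘ fmap H (i X) ∘ i (T_obj X).
Proof. rw (Gamma_mu X). now rw (Gamma_i (T_obj X)). Qed.

Lemma T_mu_proof X :
  @is_comodule_mor _ _ _ (T_obj (T_obj X)) (T_obj X)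
    (T_p X ∘ mu M (comod_obj X) ∘ fmap H (T_i X) ∘ T_i (T_obj X)).
Proof.
unfold is_comodule_mor; rewrite !T_coact; cbn; flat.
rw (T_ip X). rw (wcoact_Gamma X). rw (wcoact_mu X).
rw (fmap_eq H (T_ip (T_obj X))). now rw (Gamma_wcoact (T_obj X)).
Qed.

Definition T_mu (X : comodule C) : comodule_hom (T_obj (T_obj X)) (T_obj X) :=
  exist _ _ (T_mu_proof X).

Lemma i_T_mu X :
  i X ∘ proj1_sig (T_mu X) = m (u X) ∘ fmap H (i X) ∘ i (T_obj X).
Proof. cbn; rw (T_ip X). apply Gamma_mu_i. Qed.

Lemma Gamma_eta X : G X ∘ eta M _ = xi_of M C (omega W) _ ∘ coact X.
Proof.
unfold Gamma'; flat. rwl (eta_nat M _). rw (omega_eta W _).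
rwl (proj1 (comoduleP X)). rw (eps_nat C (xi_of M C (omega W) _)).
rw (eps_nat C (coact X)). now rw (proj2 (comoduleP X)).
Qed.

Lemma Gamma_xi X : G X = m _ ∘ fmap H (xi_of M C (omega W) _) ∘ fmap H (coact X).
Proof. unfold Gamma'; flat. now rw (omega_eps W _). Qed.

Lemma T_eta_proof X :
  @is_comodule_mor _ _ _ X (T_obj X) (T_p X ∘ eta M (comod_obj X)).
Proof.
unfold is_comodule_mor; rewrite !T_coact; cbn; flat.
rw (T_ip X). rw (wcoact_Gamma X). unfold wcoact; flat.
rwl (eta_nat M _). rw (omega_eta W _). rwl (proj1 (comoduleP X)).
rw (fmap_eq H (eq_sym (Gamma_eta X))). now rw (fmap_eq H (p_Gamma X)).
Qed.

(* The unit is p' · e_a and not p' · θ, which satisfies neither the unit laws nor, in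
   general, the comodule morphism condition: for an ordinary bialgebra Γ' = 1, while
   m_a · θ need not be the identity. *)
Definition T_eta (X : comodule C) : comodule_hom X (T_obj X) :=
  exist _ _ (T_eta_proof X).

Lemma i_T_mor X Y (f : comodule_hom X Y) :
  i Y ∘ proj1_sig (T_mor f) = fmap H (proj1_sig f) ∘ i X.
Proof. cbn; rw (T_ip Y). rw (Gamma_nat (proj2_sig f)). now rw (Gamma_i X). Qed.

Lemma i_T_eta X : i X ∘ proj1_sig (T_eta X) = G X ∘ eta M _.
Proof. cbn; now rw (T_ip X). Qed.

Local Opaque T_mor T_mu T_eta.

Definition T_monad : monad T_functor.
Proof.
refine (@Monad (comodule_cat C) T_functor T_mu T_eta _ _ _ _ _).
- intros X Y f; apply sig_inj, T_i_inj; cbn.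
  rw (i_T_mu Y). rw (i_T_mor (T_mor f)). rw (fmap_eq H (i_T_mor f)).
  rw (i_T_mor f). rw (i_T_mu X). now rw (mu_nat M _).
- intros X Y f; apply sig_inj, T_i_inj; cbn.
  rw (i_T_eta Y). rw (i_T_mor f). rw (i_T_eta X). rw (eta_nat M _).
  now rw (Gamma_nat (proj2_sig f)).
- intros X; apply sig_inj, T_i_inj; cbn.
  rw (i_T_mu X). rw (i_T_mor (T_mu X)). rw (fmap_eq H (i_T_mu X)).
  rw (i_T_mu X). rw (i_T_mu (T_obj X)). rwl (mu_nat M (i X)). now rw (mu_assoc M _).
- intros X; apply sig_inj, T_i_inj; cbn.
  rw (i_T_mu X). rw (i_T_eta (T_obj X)). rwl (Gamma_mu X). rwl (eta_nat M (i X)).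
  rw (mu_etal M _). apply Gamma_i.
- intros X; apply sig_inj, T_i_inj; cbn.
  rw (i_T_mu X). rw (i_T_mor (T_eta X)). rw (fmap_eq H (i_T_eta X)).
  rw (fmap_eq H (Gamma_eta X)). rwl (Gamma_xi X). apply Gamma_i.
Defined.

Lemma act_Gamma (X : bimodule W) : bim_act X ∘ G (bim_comod X) = bim_act X.
Proof.
destruct X as [a h t [hM [[t1 t2] ht]]]; unfold Gamma'; cbn in *.
rwl (eps_nat C h). rwl ht. now rw t2.
Qed.

Lemma Phi_act_proof (X : bimodule W) :
  @is_comodule_mor _ _ _ (T_obj (bim_comod X)) (bim_comod X)
    (bim_act X ∘ T_i (bim_comod X)).
Proof.
unfold is_comodule_mor; rewrite T_coact; flat.
rw (fmap_eq H (T_ip (bim_comod X))). rw (Gamma_wcoact (bim_comod X)).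
destruct X as [a h t [hM [ht1 ht]]]; unfold wcoact; cbn in *; flat. now rw ht.
Qed.

Definition Phi_act (X : bimodule W) :
    comodule_hom (T_obj (bim_comod X)) (bim_comod X) :=
  exist _ _ (Phi_act_proof X).

Lemma Phi_obj_proof (X : bimodule W) :
  @is_module (comodule_cat C) T_functor T_monad (bim_comod X) (Phi_act X).
Proof.
pose proof (i_T_mor (Phi_act X)) as e1; pose proof (i_T_mu (bim_comod X)) as e2.
pose proof (i_T_eta (bim_comod X)) as e3; pose proof (act_Gamma X) as e4.
pose proof (proj1 (bimoduleP X)) as [hM hE]; cbn in *.
split; apply sig_inj; cbn; flat.
- rw e1. rw e2. now rw hM.
- rw e3. rw e4. exact hE.
Qed.

Definition Phi_obj (X : bimodule W) : module T_monad := Module (Phi_obj_proof X).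

Definition bim_hom_comod (X Y : bimodule W) (f : bimodule_hom X Y) :
    comodule_hom (bim_comod X) (bim_comod Y) :=
  exist _ (proj1_sig f) (proj2 (proj2_sig f)).

Lemma Phi_mor_proof (X Y : bimodule W) (f : bimodule_hom X Y) :
  @is_module_mor _ _ _ (Phi_obj X) (Phi_obj Y) (bim_hom_comod f).
Proof.
pose proof (i_T_mor (bim_hom_comod f)) as e.
pose proof (proj1 (proj2_sig f)) as ef; unfold is_module_mor in ef; cbn in *.
apply sig_inj; cbn; flat.
rw e. now rw ef.
Qed.

Definition Phi' : functor (bimodule_cat W) (module_cat T_monad).
Proof.
refine (@Functor (bimodule_cat W) (module_cat T_monad) Phi_obj
  (fun X Y f => exist _ (bim_hom_comod f : @hom (comodule_cat C) _ _)
                        (Phi_mor_proof f)) _ _);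
  intros; apply sig_inj, sig_inj; reflexivity.
Defined.

Definition K' (Wc : compatible W) : functor A (module_cat T_monad) :=
  comp_functor Phi' (K_omega Wc).

End InducedMonad.

(* Main.v *)
(** By cofreeness of [(H b, δ)], a comodule morphism [k : X → H b] is the same thing as
    the morphism [g = ε · k : a → b], with [k = H g · θ]; compatibility shows that [k] is
    moreover a module morphism exactly when [g · h = g · ε · m · H θ].  So a universal
    arrow from [X] to [K_omega] is the same thing as a coequaliser of the pair, and a left
    adjoint is a choice of universal arrows.  The case of [K'] follows because [Phi'] is
    fully faithful and surjective on objects. *)
Require Import Defs.
From Stdlib Require Import ProofIrrelevance IndefiniteDescription.

Set Implicit Arguments.
Unset Strict Implicit.

(** * Left adjoints as families of universal arrows *)

Section UniversalArrows.
Context (A B : category) (G : functor A B).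

Definition is_universal_arrow (b : B) (c : A) (e : hom b (G c)) : Prop :=
  forall (z : A) (k : hom b (G z)), exists! v : hom c z, fmap G v ∘ e = k.

Definition has_universal_arrow (b : B) : Prop :=
  exists (c : A) (e : hom b (G c)), is_universal_arrow e.

Lemma left_adjoint_universal_arrow (b : B) :
  has_left_adjoint G -> has_universal_arrow b.
Proof.
intros [F [J]]; exists (F b), (adj_unit J b); intros z k.
exists (adj_counit J z ∘ fmap F k); split.
- flat. rwl (adj_unit_nat J k). now rw (adj_triangle_right J z).
- intros v e. rewrite <- e. rw (adj_counit_nat J v). now rw (adj_triangle_left J b).
Qed.

Section Choice.
Context (F : B -> A) (e : forall b, hom b (G (F b)))
  (lift : forall {b z}, hom b (G z) -> hom (F b) z)
  (lift_unit : forall b z (k : hom b (G z)), fmap G (lift k) ∘ e b = k)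
  (lift_unique : forall b z (v v' : hom (F b) z),
     fmap G v ∘ e b = fmap G v' ∘ e b -> v = v').

(** [F] sends [f] to the lift of [e b' ∘ f], and the counit is the lift of the identity. Every law
    not immediate from [lift_unit] compares two lifts after composing with the unit. *)
Lemma universal_arrows_left_adjoint : has_left_adjoint G.
Proof.
unshelve eexists (@Functor B A F (fun b b' f => lift (e b' ∘ f)) _ _).
- intros b; apply lift_unique. rewrite lift_unit. now flat.
- intros b b' b'' g f; apply lift_unique. rewrite lift_unit. flat.
  now rw (lift_unit (e b' ∘ f)); rw (lift_unit (e b'' ∘ g)).
- constructor.
  unshelve eexists e (fun a => lift (idm (G a))).
  + intros b b' f; cbn. now rewrite lift_unit.
  + intros a a' f; cbn; apply lift_unique; flat.
    rw (lift_unit (e (G a') ∘ fmap G f)). rw (lift_unit (idm (G a'))).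
    now rw (lift_unit (idm (G a))).
  + intros b; cbn; apply lift_unique; flat.
    rw (lift_unit (e (G (F b)) ∘ e b)). now rw (lift_unit (idm (G (F b)))).
  + intros a; apply lift_unit.
Qed.

End Choice.

Lemma has_left_adjointP :
  has_left_adjoint G <-> forall b, has_universal_arrow b.
Proof.
split; [intros L b; now apply left_adjoint_universal_arrow |].
intros U.
(* Universal arrows and factorisations are only known to exist; indefinite description turns them
   into functions. *)
pose (F b := proj1_sig (constructive_indefinite_description _ (U b))).
pose (s b := constructive_indefinite_description _
  (proj2_sig (constructive_indefinite_description _ (U b)))).
pose (e b := proj1_sig (s b) : hom b (G (F b))).
assert (eU : forall b, is_universal_arrow (e b)) by (intros b; exact (proj2_sig (s b))).
pose (l b z (k : hom b (G z)) := constructive_indefinite_description _ (eU b z k)).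
apply (@universal_arrows_left_adjoint F e (fun b z k => proj1_sig (l b z k))).
- intros b z k; exact (proj1 (proj2_sig (l b z k))).
- intros b z v v' ev. destruct (eU b z (fmap G v' ∘ e b)) as [x [_ ux]].
  rewrite <- (ux v ev). now apply ux.
Qed.

End UniversalArrows.

(** * Composition with a fully faithful functor *)

Section FullyFaithful.
Context (A B D : category) (P : functor B D) (G : functor A B).
Context (P_full : forall {a b} (k : hom (P a) (P b)), exists f, fmap P f = k)
  (P_faithful : forall a b (f g : hom a b), fmap P f = fmap P g -> f = g).

(** [P] gives bijections from [hom b (G z)] to [hom (P b) (P (G z))], compatible with composition by
    [fmap G v], so factorisations on the two sides correspond. *)
Lemma universal_arrow_fully_faithful (b : B) :
  has_universal_arrow (comp_functor P G) (P b) <-> has_universal_arrow G b.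
Proof.
split; intros [c [e U]].
- destruct (P_full (b := G c) e) as [e' <-]. exists c, e'; intros z k.
  destruct (U z (fmap P k)) as [v [ev uv]]; exists v; split.
  + apply P_faithful; rewrite <- ev; cbn; now flat.
  + intros v' ev'; apply uv; cbn. now rewrite <- fmap_comp, ev'.
- exists c, (fmap P e); intros z k. destruct (P_full (b := G z) k) as [k' <-].
  destruct (U z k') as [v [ev uv]]; exists v; split.
  + cbn. now rewrite <- fmap_comp, ev.
  + intros v' ev'; apply uv, P_faithful; rewrite <- ev'; cbn; now flat.
Qed.

Lemma left_adjoint_fully_faithful (P_surj : forall d, exists b, P b = d) :
  has_left_adjoint (comp_functor P G) <-> has_left_adjoint G.
Proof.
rewrite !has_left_adjointP; split; intros U.
- intros b; now apply universal_arrow_fully_faithful.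
- intros d; destruct (P_surj d) as [b <-]; now apply universal_arrow_fully_faithful.
Qed.

End FullyFaithful.

(** * Universal arrows to [K_omega] as coequalisers *)

Section Entwining.
Context (A : category) (H : functor A A) (M : monad H) (C : comonad H)
  (W : weak_entwining M C) (Wc : compatible W).

Lemma comodule_mor_transpose (X : bimodule W) b (f : hom (bim_obj X) (H b)) :
  @is_bimodule_mor _ _ _ _ W X (K_obj Wc b) f ->
  fmap H (eps C b ∘ f) ∘ bim_coact X = f.
Proof.
intros [_ e]; unfold is_comodule_mor in e; cbn in *.
rwl e. now rw (eps_deltar C b).
Qed.

(** Linearity turns [f · h] into [m · H f]; replacing this [f] by [H (ε · f) · θ] and moving
    everything past [m] and [ε] by naturality gives the right-hand side. *)
Lemma transpose_mor (X : bimodule W) b (f : hom (bim_obj X) (H b)) :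
  @is_bimodule_mor _ _ _ _ W X (K_obj Wc b) f ->
  (eps C b ∘ f) ∘ bim_act X =
  (eps C b ∘ f) ∘ eps C (bim_obj X) ∘ mu M (bim_obj X) ∘ fmap H (bim_coact X).
Proof.
intros fX; pose proof (proj1 fX) as e; unfold is_module_mor in e; cbn in *.
flat; rewrite e, <- (comodule_mor_transpose fX) at 1.
rw (mu_nat M (eps C b)). rw (mu_nat M f).
rw (eps_nat C (eps C b)). now rw (eps_nat C f).
Qed.

(** For linearity, the mixed law rewrites [H g · θ · h] as [H (g · h) · ω · H θ]. After substituting
    the hypothesis, naturality of [ω] and coassociativity of [θ] produce [H m · ω · H δ], which
    compatibility turns into [δ · m]; then [H ε · δ = 1]. *)
Lemma mor_transpose (X : bimodule W) b (g : hom (bim_obj X) b) :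
  g ∘ bim_act X = g ∘ eps C (bim_obj X) ∘ mu M (bim_obj X) ∘ fmap H (bim_coact X) ->
  @is_bimodule_mor _ _ _ _ W X (K_obj Wc b) (fmap H g ∘ bim_coact X).
Proof.
intros e; destruct X as [a h t [hM [[t1 t2] th]]]; cbn in *; split;
  unfold is_module_mor, is_comodule_mor; cbn; flat.
- rw th. rw (fmap_eq H e). rwl (omega_nat W t). rw (fmap_eq H t1).
  rwl (Wc a). rw (eps_deltar C a). now rw (mu_nat M g).
- rw (delta_nat C g). now rw t1.
Qed.

Lemma K_universal_arrowP (X : bimodule W) c (k : bimodule_hom X (K_obj Wc c)) :
  @is_universal_arrow _ _ (K_omega Wc) X c k <->
  is_coequaliser (bim_act X)
    (eps C (bim_obj X) ∘ mu M (bim_obj X) ∘ fmap H (bim_coact X))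
    (eps C c ∘ proj1_sig k).
Proof.
destruct k as [k kX]; cbn.
(* Transposition carries factorisations through [k] to factorisations through [ε · k]. *)
assert (tr : forall z (v : hom c z) (f : bimodule_hom X (K_obj Wc z)),
  fmap (K_omega Wc) v ∘ (exist _ k kX : @hom (bimodule_cat W) X (K_obj Wc c)) = f <->
  v ∘ eps C c ∘ k = eps C z ∘ proj1_sig f).
{ intros z v [f fX]; split; intros e.
  - rewrite <- e; cbn. now rw (eps_nat C v).
  - apply sig_inj; cbn in *.
    rewrite <- (comodule_mor_transpose kX), <- (comodule_mor_transpose fX), <- e.
    now flat. }
split.
- intros U; split; [now rewrite transpose_mor |]; intros z g eg.
  pose (f := exist _ _ (mor_transpose eg) : bimodule_hom X (K_obj Wc z)).
  assert (ef : eps C z ∘ proj1_sig f = g).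
  { cbn. rw (eps_nat C g). now rw (proj2 (proj1 (proj2 (bimoduleP X)))). }
  destruct (U z f) as [v [ev uv]]; exists v; split.
  + rewrite <- ef; now apply tr.
  + intros v' ev'; apply uv, tr; now rewrite ef.
- intros [_ U] z f.
  destruct (U z _ (transpose_mor (proj2_sig f))) as [v [ev uv]].
  exists v; split; [now apply tr |]; intros v' ev'; now apply uv, tr.
Qed.

Lemma K_has_universal_arrowP (X : bimodule W) :
  @has_universal_arrow _ _ (K_omega Wc) X <->
  has_coequaliser (bim_act X)
    (eps C (bim_obj X) ∘ mu M (bim_obj X) ∘ fmap H (bim_coact X)).
Proof.
split.
- intros [c [k U]]; exists c, (eps C c ∘ proj1_sig k).
  exact (proj1 (K_universal_arrowP k) U).
- intros [c [q Q]].
  exists c, (exist _ _ (mor_transpose (proj1 Q))).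
  apply K_universal_arrowP; cbn. rw (eps_nat C q).
  now rw (proj2 (proj1 (proj2 (bimoduleP X)))).
Qed.

(** * [Phi'] is fully faithful and surjective on objects *)

Section Phi.
Context (S : forall X : comodule C, splitting (Gamma' W X)).

(** [Γ'] is [m · H (ξ · θ)], hence linear between free modules by associativity. *)
Lemma mu_Gamma (X : comodule C) :
  mu M (comod_obj X) ∘ fmap H (Gamma' W X) = Gamma' W X ∘ mu M (comod_obj X).
Proof.
rewrite Gamma_xi; flat. rw (mu_assoc M _). rwl (mu_nat M (coact X)).
now rwl (mu_nat M (xi_of M C (omega W) (comod_obj X))).
Qed.

Lemma module_eq (B : category) (F : functor B B) (N : monad F) (b : B)
    (h h' : hom (F b) b) (hP : is_module N h) (hP' : is_module N h') :
  h = h' -> Module hP = Module hP'.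
Proof. intros e; subst h'; f_equal; apply proof_irrelevance. Qed.

Local Opaque T_obj T_p T_i T_mor T_mu T_eta.

(** Inverse of [Phi'] on objects: the action [k] on [T X] is extended to [H a] along [p']. *)
Lemma T_module_bimodule (X : comodule C) (k : comodule_hom (T_obj S X) X) :
  @is_module (comodule_cat C) (T_functor S) (T_monad S) X k ->
  is_mixed_bimodule W (proj1_sig k ∘ T_p S X) (coact X).
Proof.
intros [kM kE].
apply (f_equal (@proj1_sig _ _)) in kM, kE; cbn in kM, kE.
pose proof (Gamma_nat W (proj2_sig k)) as kG.
assert (kC : coact X ∘ proj1_sig k = fmap H (proj1_sig k) ∘ coact (T_obj S X))
  by exact (proj2_sig k).
rewrite T_coact in kC.
pose proof (i_T_mor S k) as e1; pose proof (i_T_mu S X) as e2.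
pose proof (i_T_eta S X) as e3; cbn in *.
assert (pi : forall z (f : hom z _), T_p S X ∘ T_i S X ∘ f = f)
  by (intros z f; now rw (T_pi S X)).
split; [split | split; [exact (comoduleP X) |]].
- rewrite <- (pi _ (proj1_sig (T_mor S k))), <- (pi _ (proj1_sig (T_mu S X))), e1, e2 in kM.
  (* Precomposing moves the law from [T T X] to [H H a]; the idempotents that appear slide left and
     are absorbed by [p']. *)
  apply (f_equal (fun f => f ∘ T_p S (T_obj S X) ∘ fmap H (T_p S X))) in kM.
  revert kM; rw (T_ip S (T_obj S X)). rwl kG. rw (p_Gamma S X).
  rwl (Gamma_mu S X). rw (p_Gamma S X). rw (fmap_eq H (T_ip S X)).
  rw (mu_Gamma X). rw (p_Gamma S X). auto.
- rewrite <- (pi _ (proj1_sig (T_eta S X))), e3 in kE.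
  revert kE; now rw (p_Gamma S X).
- rw kC. rw (T_ip S X). rw (wcoact_Gamma W X). unfold wcoact; now flat.
Qed.

Lemma Phi_surj (Z : module_cat (T_monad S)) : exists X, Phi' S X = Z.
Proof.
destruct Z as [X k kP]; change (comodule_hom (T_obj S X) X) in k.
pose proof (T_module_bimodule kP) as P; remember (proj1_sig k ∘ T_p S X) as h eqn:hk.
destruct X as [a t tP]; cbn in h, P.
(* [proj1] is opaque, so [bim_comod] returns [a] with another proof of the axioms. *)
pose proof (proof_irrelevance _ tP (proj1 (proj2 P))) as e; subst tP.
exists (Bimodule P).
apply module_eq, sig_inj; cbn.
refine (eq_trans (f_equal (fun h => h ∘ T_i S _) hk) _). now rw (T_pi S _).
Qed.

(** Since [h = h · Γ' = h · i' · p'], an action is determined by its restriction along [i'], so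
    [T]-linearity of a comodule morphism gives [H]-linearity. *)
Lemma Phi_full (X Y : bimodule W) (k : hom (Phi' S X) (Phi' S Y)) :
  exists f : bimodule_hom X Y, fmap (Phi' S) f = k.
Proof.
destruct k as [[f fC] fM].
assert (fB : @is_bimodule_mor _ _ _ _ W X Y f).
{ split; [| exact fC]; unfold is_module_mor; cbn in *.
  apply (f_equal (@proj1_sig _ _)) in fM; cbn in fM.
  pose proof (i_T_mor S (X := bim_comod X) (Y := bim_comod Y) (exist _ f fC)) as e.
  pose proof (@Gamma_nat _ _ _ _ W (bim_comod X) (bim_comod Y) f fC) as g.
  pose proof (T_ip S (bim_comod X)) as ip; pose proof (act_Gamma Y) as aY.
  cbn in *; rewrite <- (act_Gamma X), <- ip.
  rw fM. rw e. rw ip. rwl g. now rw aY. }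
exists (exist _ f fB); now apply sig_inj, sig_inj.
Qed.

Lemma Phi_faithful (X Y : bimodule W) (f g : bimodule_hom X Y) :
  fmap (Phi' S) f = fmap (Phi' S) g -> f = g.
Proof.
intros e; apply sig_inj; exact (f_equal (fun k => proj1_sig (proj1_sig k)) e).
Qed.

Lemma K'_left_adjointP : has_left_adjoint (K' S Wc) <-> has_left_adjoint (K_omega Wc).
Proof. exact (left_adjoint_fully_faithful (K_omega Wc) Phi_full Phi_faithful Phi_surj). Qed.

End Phi.
End Entwining.

Theorem proposition5p11 (A : category) (H : functor A A) (M : monad H) (C : comonad H)
    (W : weak_entwining M C) (Wc : compatible W)
    (S : forall X : comodule C, splitting (Gamma' W X)) :
  (has_left_adjoint (K' S Wc) <->
   forall X : bimodule W,
     has_coequaliser (bim_act X)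
       (eps C (bim_obj X) ∘ mu M (bim_obj X) ∘ fmap H (bim_coact X)))
  /\
  (has_left_adjoint (K_omega Wc) <->
   forall X : bimodule W,
     has_coequaliser (bim_act X)
       (eps C (bim_obj X) ∘ mu M (bim_obj X) ∘ fmap H (bim_coact X))).
Proof.
rewrite K'_left_adjointP, has_left_adjointP.
split; split; intros E X; now apply (K_has_universal_arrowP Wc).
Qed.
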